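(* Let $a_0=0$ and, for $n\ge 1$, let $a_n$ be the $n$th entry of the infinite list $A$ defined below, and let $s_n=a_0+a_1+\cdots+a_n$. Let $(c_n)_{n\ge1}$ be the Conolly–Fox sequence, defined by $c_1=1$, $c_2=2$ and, for $n\ge 3$, \[ c_n=c_{n-c_{n-1}}+c_{n-1-c_{n-2}}. \] Then for each positive integer $n$, $s_n=4c_n+n$.
   Context: The list $A$: let $A_1=(5)$ and for $k\ge 2$ let $A_k$ be the concatenation $A_{k-1},A_{k-1},(1)$. Each $A_{k-1}$ is a prefix of $A_k$, and $A$ is the limiting infinite list (beginning $5,5,1,5,5,1,1,5,5,1,5,5,1,1,1,\dots$). *)

(* Defs.v *)
From mathcomp Require Import all_boot.
From mathcomp Require Import zify.

Set Implicit Arguments.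
Unset Strict Implicit.
Unset Printing Implicit Defensive.

(* The finite lists A_k, for k >= 1; the value at k = 0 is a dummy. *)
Fixpoint A_block (k : nat) : seq nat :=
  match k with
  | 0 => [::]
  | 1 => [:: 5]
  | k'.+1 => A_block k' ++ A_block k' ++ [:: 1]
  end.

(* The n-th entry (counted from 1) of the infinite list is read off from the
   prefix A_n, which has 2 ^ n - 1 >= n entries; by [A_entry_block] any other
   long enough A_k gives the same value. *)
Definition A_entry (n : nat) : nat := nth 0 (A_block n) n.-1.

Definition a_ (n : nat) : nat := if n == 0 then 0 else A_entry n.

Definition s_ (n : nat) : nat := \sum_(0 <= i < n.+1) a_ i.

(* c_n is represented by [c n] for n >= 1; [c 0] is unconstrained. By
   [conolly_fox_index] the subtractions are never truncated and the recurrence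
   never refers to [c 0]; by [conolly_fox_exists] such a sequence exists. *)
Definition conolly_fox (c : nat -> nat) : Prop :=
  [/\ c 1 = 1, c 2 = 2 &
      forall n, 3 <= n -> c n = c (n - c (n - 1)) + c (n - 1 - c (n - 2))].

Lemma A_blockS k : 0 < k ->
  A_block k.+1 = A_block k ++ A_block k ++ [:: 1].
Proof. by case: k. Qed.

Lemma size_A_block k : size (A_block k) = 2 ^ k - 1.
Proof.
elim: k => [//|[//|k] IH].
rewrite A_blockS // !size_cat IH /= [2 ^ k.+2]expnS.
have : 0 < 2 ^ k.+1 by rewrite expn_gt0.
lia.
Qed.

Lemma A_block_prefix j k : 0 < j -> j <= k -> prefix (A_block j) (A_block k).
Proof.
move=> j0; elim: k => [|k IH]; first by case: j j0.
rewrite leq_eqVlt => /orP[/eqP <-|]; first exact: prefix_refl.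
rewrite ltnS => jk.
apply: prefix_trans (IH jk) _.
by rewrite A_blockS ?prefix_prefix //; lia.
Qed.

Lemma A_entry_block n k : 0 < n -> n <= size (A_block k) ->
  nth 0 (A_block k) n.-1 = A_entry n.
Proof.
move=> n0 nk; rewrite /A_entry.
have nn : n <= size (A_block n).
  by rewrite size_A_block; have := ltn_expl n (isT : 1 < 2); lia.
have k0 : 0 < k by case: k nk => //=; lia.
case: (leqP k n) => kn.
  have /prefixP[t ->] := A_block_prefix k0 kn.
  by rewrite nth_cat ifT //; lia.
have /prefixP[t ->] := A_block_prefix n0 (ltnW kn).
by rewrite nth_cat ifT //; lia.
Qed.

(* The recurrence is assumed only up to rank N, so that the lemma also applies
   to the finite tables used in the existence proof. *)
Lemma conolly_fox_slow (c : nat -> nat) N :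
  c 1 = 1 -> c 2 = 2 ->
  (forall n, 3 <= n <= N ->
     c n = c (n - c (n - 1)) + c (n - 1 - c (n - 2))) ->
  forall n, 1 <= n < N -> c n <= c n.+1 <= (c n).+1.
Proof.
move=> c1 c2 rec; elim/ltn_ind=> n IH /andP[n0 nN].
have mono i j : 1 <= i -> i <= j -> j <= n -> c i <= c j <= c i + (j - i).
  move=> i1; elim: j => [|j IHj]; first by lia.
  rewrite leq_eqVlt => /orP[/eqP <-|]; first by lia.
  rewrite ltnS => ij jn; have := IHj ij (ltnW jn).
  have : c j <= c j.+1 <= (c j).+1 by apply: IH; lia.
  lia.
have rg i : 1 <= i -> i <= n -> 1 <= c i <= i.
  by move=> i1 i_n; have := mono 1 i isT i1 i_n; rewrite c1; lia.
have [n1|[n2|n3]] : n = 1 \/ n = 2 \/ 3 <= n by lia.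
- by rewrite n1 c1 c2.
- rewrite n2; have r3 : 3 <= 3 <= N by lia.
  have := rec 3 r3.
  by rewrite !subSS !subn0 c1 c2 !subSS !subn0 c1 => ->.
have e1 := rec n.+1 ltac:(lia); have e0 := rec n ltac:(lia).
have f1 : n.+1 - 1 = n by lia.
have f2 : n.+1 - 2 = n - 1 by lia.
rewrite f1 f2 in e1.
have r0 := rg n n0 (leqnn _).
have r1 := rg (n - 1) ltac:(lia) ltac:(lia).
have r2 := rg (n - 2) ltac:(lia) ltac:(lia).
have d0 := mono (n - 1) n ltac:(lia) ltac:(lia) ltac:(lia).
have d1 := mono (n - 2) (n - 1) ltac:(lia) ltac:(lia) ltac:(lia).
have m := mono (n - 1 - c (n - 2)) (n.+1 - c n)
  ltac:(lia) ltac:(lia) ltac:(lia).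
have [j2|j2] : c n = c (n - 2) \/ c (n - 2) < c n by lia.
  have [n_3|n4] : n = 3 \/ 4 <= n by lia.
    have := rg 2 isT; move: j2; rewrite n_3 /= c1.
    by have := mono 2 3 isT isT; rewrite c2; lia.
  have e2 := rec (n - 1) ltac:(lia).
  have g1 : n - 1 - 1 = n - 2 by lia.
  have g2 : n - 1 - 2 = n - 3 by lia.
  rewrite g1 g2 in e2.
  have r3 := rg (n - 3) ltac:(lia) ltac:(lia).
  have d2 := mono (n - 3) (n - 2) ltac:(lia) ltac:(lia) ltac:(lia).
  have h1 := mono (n - 2 - c (n - 3)) (n - 1 - c (n - 2))
    ltac:(lia) ltac:(lia) ltac:(lia).
  have h2 := mono (n - 1 - c (n - 2)) (n - c (n - 1))
    ltac:(lia) ltac:(lia) ltac:(lia).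
  have h3 := mono (n - c (n - 1)) (n.+1 - c n)
    ltac:(lia) ltac:(lia) ltac:(lia).
  lia.
lia.
Qed.

Lemma conolly_fox_range (c : nat -> nat) N :
  c 1 = 1 -> c 2 = 2 ->
  (forall n, 3 <= n <= N ->
     c n = c (n - c (n - 1)) + c (n - 1 - c (n - 2))) ->
  forall n, 1 <= n <= N -> 1 <= c n <= n.
Proof.
move=> c1 c2 rec; elim=> [//|[_ _|n IH nN]]; first by rewrite c1.
have := IH ltac:(lia); have := conolly_fox_slow c1 c2 rec (n := n.+1) ltac:(lia).
lia.
Qed.

Lemma conolly_fox_index (c : nat -> nat) n : conolly_fox c -> 3 <= n ->
  [/\ c (n - 1) < n, c (n - 2) < n - 1,
      n - c (n - 1) < n & n - 1 - c (n - 2) < n].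
Proof.
case=> c1 c2 rec n3.
have rg := conolly_fox_range c1 c2 (N := n)
  (fun m (h : 3 <= m <= n) => rec m (proj1 (andP h))).
have := rg (n - 1) ltac:(lia); have := rg (n - 2) ltac:(lia).
by move=> ? ?; split; lia.
Qed.

Fixpoint cf_table (N : nat) : nat -> nat :=
  match N with
  | 0 => id
  | N'.+1 => let c := cf_table N' in fun n =>
      if (n == N) && (3 <= n) then c (n - c (n - 1)) + c (n - 1 - c (n - 2))
      else c n
  end.

Lemma cf_table_stable M N n : n <= M -> M <= N -> cf_table N n = cf_table M n.
Proof.
move=> nM; elim: N => [|N IH]; first by move=> ?; have -> : M = 0 by lia.
rewrite leq_eqVlt => /orP[/eqP <- //|]; rewrite ltnS => MN /=.
by rewrite ifF ?IH //; lia.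
Qed.

Lemma cf_table_rec N (c := cf_table N) n : 3 <= n <= N ->
  c n = c (n - c (n - 1)) + c (n - 1 - c (n - 2)).
Proof.
have base2 M : cf_table M 2 = 2.
  elim: M => [//|M IH]; by rewrite /= andbF.
have base1 M : cf_table M 1 = 1.
  elim: M => [//|M IH]; by rewrite /= andbF.
rewrite {}/c; elim: N n => [|N IH] n nN; first by lia.
have rg := conolly_fox_range (base1 N) (base2 N) IH.
have st m : m <= N -> cf_table N.+1 m = cf_table N m.
  by move=> mN; apply: cf_table_stable.
have [nE|nlt] : n = N.+1 \/ n <= N by lia.
  have rg1 := rg (n - 1) ltac:(lia); have rg2 := rg (n - 2) ltac:(lia).
  rewrite (st (n - 1)) ?(st (n - 2)); try lia.
  rewrite (st (n - cf_table N (n - 1))); try lia.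
  rewrite (st (n - 1 - cf_table N (n - 2))); try lia.
  by rewrite [LHS]/= ifT //; lia.
rewrite (st (n - 1)) ?(st (n - 2)) ?(st n); try lia.
rewrite (st (n - cf_table N (n - 1))); try lia.
rewrite (st (n - 1 - cf_table N (n - 2))); try lia.
by apply: IH; lia.
Qed.

Lemma conolly_fox_exists : exists c, conolly_fox c.
Proof.
exists (fun n => cf_table n n); split=> // n n3.
have diag m : m <= n -> cf_table m m = cf_table n m.
  by move=> mn; rewrite (@cf_table_stable m n).
rewrite (diag (n - 1)) ?(diag (n - 2)); try lia.
rewrite (diag (n - _)) ?(diag (n - 1 - _)); try lia.
by apply: cf_table_rec; lia.
Qed.

(* Main.v *)
Require Import Defs.
From mathcomp Require Import all_boot.
From mathcomp Require Import zify.

Set Implicit Arguments.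
Unset Strict Implicit.
Unset Printing Implicit Defensive.

(** The list A is the fixed point of the substitution 5 -> 5,5,1 and 1 -> 1.
    Let C n be the number of 5s among the first n entries, so that
    s_n = 4 C n + n.  Substituting into a prefix of length j containing m fives
    gives a prefix of length j + 2m containing 2m fives; following the
    intermediate positions as well yields C (n - C (n - 1)) = ceil (C n / 2).
    Moreover an odd value of C is taken only once, so that
    ceil (C n / 2) + ceil (C (n - 1) / 2) = C n, and C is the
    Conolly-Fox sequence. *)

Definition subst5 (l : seq nat) : seq nat :=
  flatten [seq if x == 5 then [:: 5; 5; 1] else [:: 1] | x <- l].

Definition count5 (l : seq nat) : nat := count_mem 5 l.

Lemma subst5_cat l1 l2 : subst5 (l1 ++ l2) = subst5 l1 ++ subst5 l2.
Proof. by rewrite /subst5 map_cat flatten_cat. Qed.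

Lemma A_block_subst5 k : 0 < k -> A_block k.+1 = subst5 (A_block k).
Proof.
elim: k => [//|[//|k] IH] _.
by rewrite [in RHS]A_blockS // !subst5_cat -IH // A_blockS.
Qed.

Lemma count5_take_le i l : count5 (take i l) <= i.
Proof. by apply: leq_trans (count_size _ _) _; rewrite size_take_min geq_minl. Qed.

(** Every image ends in its only [1], so [j] counts the images completed before position [i] and is
    the index in [l] of the letter whose image covers that position. If m fives precede this letter,
    they yield 2m fives in [t]; when it is itself a 5, its image has added one or two more. *)
Lemma uphalf_count5_subst5 l i : i < size (subst5 l) ->
  let t := subst5 l in let j := i - count5 (take i t) in
  j < size l /\ count5 (take j.+1 l) = uphalf (count5 (take i.+1 t)).
Proof.
elim: l i => [//|x l IH] i /=.
rewrite /subst5 /= -/(subst5 l).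
case: (x == 5) => /=.
  case: i => [|[|[|i]]] /=; rewrite ?take0 //= => lt_i.
  have [lt_j e] := IH i lt_i; have := count5_take_le i (subst5 l).
  rewrite /count5 /= -!/(count5 _) => le_i.
  (* Passing the image of a leading 5 adds 3 entries and 2 fives, hence 1 to [j]; [le_i] rules out
     truncation. *)
  have -> : i.+3 - (1 + (1 + (0 + count5 (take i (subst5 l))))) =
            (i - count5 (take i (subst5 l))).+1 by lia.
  by split=> //; rewrite e; lia.
case: i => [|i] /=; rewrite ?take0 /count5 /= // -!/(count5 _) => lt_i.
have [lt_j e] := IH i lt_i; have le_i := count5_take_le i (subst5 l).
by rewrite !add0n subSn //; split.
Qed.

(** At a 5 the count rises from p to p + 1, and ceil (p / 2) + ceil ((p + 1) / 2) = p + 1. The count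
    repeats only at a [1], where it is even. *)
Lemma uphalf_count5_succ l i : i < size (subst5 l) ->
  uphalf (count5 (take i.+1 (subst5 l))) + uphalf (count5 (take i (subst5 l))) =
  count5 (take i.+1 (subst5 l)).
Proof.
elim: l i => [//|x l IH] i /=.
rewrite /subst5 /= -/(subst5 l).
case: (x == 5) => /=.
  case: i => [|[|[|i]]] /=; rewrite ?take0 //= => lt_i.
  have := IH i lt_i; rewrite /count5 /=; lia.
by case: i => [|i] /=; rewrite ?take0 //=; apply: IH.
Qed.

Definition A_prefix (n : nat) : seq nat := mkseq (fun i => A_entry i.+1) n.

Lemma take_A_block n k : n <= size (A_block k) ->
  take n (A_block k) = A_prefix n.
Proof.
move=> le_n; apply: (@eq_from_nth _ 0); rewrite size_takel ?size_mkseq // => i lt_i.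
rewrite nth_take // nth_mkseq // -(@A_entry_block i.+1 k) //.
exact: leq_trans le_n.
Qed.

Definition C (n : nat) : nat := count5 (A_prefix n).

Lemma leq_size_A_block n : n <= size (A_block n).
Proof. by rewrite size_A_block; have := ltn_expl n (isT : 1 < 2); lia. Qed.

Lemma C_recurrence n : 0 < n ->
  uphalf (C n.+1) + uphalf (C n) = C n.+1 /\
  C (n.+1 - C n) = uphalf (C n.+1).
Proof.
move=> n0; have le_n := leq_size_A_block n.+1.
(* Both counting lemmas are applied at position [n] of [A_block n.+1], read as the image of
   [A_block n]. *)
have := le_n; rewrite A_block_subst5 // => lt_n.
have le_C : C n <= n by rewrite /C -(take_A_block (ltnW le_n)) count5_take_le.
have [lt_j] := uphalf_count5_subst5 lt_n; have := uphalf_count5_succ lt_n.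
move: lt_j; rewrite -A_block_subst5 //.
rewrite (take_A_block le_n) (take_A_block (ltnW le_n)) -!/(C _) => lt_j e.
by rewrite (take_A_block lt_j) (subSn le_C).
Qed.

Lemma conolly_fox_C : conolly_fox C.
Proof.
split=> // -[|[|[|n]]] // _; rewrite subn1 subn2 /=.
have [e ->] := @C_recurrence n.+2 isT.
by have [_ ->] := @C_recurrence n.+1 isT.
Qed.

Lemma A_entry_1or5 n : 0 < n -> A_entry n = 5 \/ A_entry n = 1.
Proof.
move=> n0; rewrite /A_entry.
have : nth 0 (A_block n) n.-1 \in A_block n.
  by apply: mem_nth; rewrite prednK // leq_size_A_block.
move: (nth _ _ _) => x; elim: n {n0} => [//|[|n] IH].
  by rewrite inE => /eqP; left.
rewrite A_blockS // !mem_cat inE => /or3P[/IH//|/IH//|/eqP].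
by right.
Qed.

Lemma s_C n : s_ n = 4 * C n + n.
Proof.
elim: n => [|n IH]; first by rewrite /s_ big_nat1.
rewrite /s_ big_nat_recr //= -/(s_ n) IH /a_ /C /A_prefix mkseqS /count5.
rewrite -cats1 count_cat /=.
(* Either value of an entry x satisfies x = 4 [x = 5] + 1. *)
by have [->|->] := @A_entry_1or5 n.+1 isT; rewrite /=; lia.
Qed.

Lemma conolly_fox_unique c d : conolly_fox c -> conolly_fox d ->
  forall n, 0 < n -> c n = d n.
Proof.
move=> hc hd; elim/ltn_ind=> n IH n0.
case: (hc) (hd) => c1 c2 crec [d1 d2 drec].
have [->|[->|n3]] : n = 1 \/ n = 2 \/ 3 <= n by lia.
- by rewrite c1 d1.
- by rewrite c2 d2.
have [? ? ? ?] := conolly_fox_index hc n3.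
(* The inner values at [n - 1] and [n - 2] are identified first; then both sides have the same outer
   arguments, which are positive and below [n]. *)
rewrite crec // drec // -(IH (n - 1)) -?(IH (n - 2)); try lia.
by congr (_ + _); apply: IH; lia.
Qed.

Theorem theorem6p1 (c : nat -> nat) (hc : conolly_fox c)
  (n : nat) (hn : 0 < n) : s_ n = 4 * c n + n.
Proof. by rewrite s_C (conolly_fox_unique hc conolly_fox_C hn). Qed.
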